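(* Consider the Lax–Wendroff Flux Reconstruction (LWFR) scheme of polynomial degree $N\ge 1$ on a curvilinear mesh, as described in the context, for the conservation law $\boldsymbol u_t+\sum_{n=1}^d\partial_{x_n}\boldsymbol f_n(\boldsymbol u)=\boldsymbol 0$. Let $\mathbb{I}_N(J\boldsymbol a^i)$ denote the degree $N$ polynomial approximation of the metric terms $J\boldsymbol a^i$ used by the scheme in each element. Assume that (i) the metric identities hold in every element: $$\sum_{i=1}^d\frac{\partial}{\partial\xi^i}\,\mathbb{I}_N(J\boldsymbol a^i)=\boldsymbol 0;$$ (ii) the mesh is well-constructed, i.e. at the element faces $$\sum_{m=1}^d\big(\mathbb{I}_N(J\boldsymbol a^m)^+-\mathbb{I}_N(J\boldsymbol a^m)^-\big)(\hat{\boldsymbol n}_{S,i})_m=\boldsymbol 0\qquad\text{for all }1\le i\le d,\ S\in\{L,R\},$$ where $\pm$ denote the trace values from the element and from its neighbour across the face $(S,i)$. Suppose that the solution at time level $n$ is constant in space, $\boldsymbol u^n=\boldsymbol c$. Then the element-local time averaged flux and the time averaged solution satisfy $$\tilde{\boldsymbol F}^\delta=\tilde{\boldsymbol f}^\delta(\boldsymbol c)=\big\{\mathbb{I}_N(J\boldsymbol a^i)\cdot\boldsymbol f(\boldsymbol c)\big\}_{i=1}^d,\qquad \boldsymbol U=\boldsymbol u^\delta=\boldsymbol c,$$ and both the volume terms and the surface terms of the LWFR update vanish, so that $\boldsymbol u^{n+1}=\boldsymbol c$. That is, the LWFR scheme preserves the free stream (constant states).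
   Context: **Mesh and metric terms.** The domain $\Omega\subset\mathbb R^d$ is partitioned into non-overlapping quadrilateral/hexahedral, possibly curved, elements $\Omega_e=\Theta_e(\Omega_o)$, $\Omega_o=[-1,1]^d$, where $\Theta_e$ is a bijective map given by tensor product Lagrange interpolation of degree $N$ at the Gauss–Legendre–Lobatto (GLL) points. $\xi_0,\dots,\xi_N$ are the 1-D GLL points with Lagrange polynomials $\ell_0,\dots,\ell_N$; for $\boldsymbol p\in\{0,\dots,N\}^d$, $\boldsymbol\xi_{\boldsymbol p}=(\xi_{p_i})_{i=1}^d$ are the solution points and $\ell_{\boldsymbol p}(\boldsymbol\xi)=\prod_{i=1}^d\ell_{p_i}(\xi^i)$. $J$ is the Jacobian determinant of $\Theta_e$ (values $J_{e,\boldsymbol p}$ at solution points), $\boldsymbol a^i=\nabla_{\boldsymbol x}\xi^i$ are the contravariant basis vectors, and the vectors $J\boldsymbol a^i$ are the metric terms. $\mathbb{I}_N(J\boldsymbol a^i)=(\mathbb{I}_N(Ja^i_1),\dots,\mathbb{I}_N(Ja^i_d))$ is the degree $N$ polynomial approximation of the metric terms that the scheme uses in their place (in 2-D, the metric terms computed from the degree $N$ map $\Theta_e$). The well-constructedness property is a consequence of global continuity of the reference map. **Fluxes.** The contravariant flux is $\tilde{\boldsymbol f}^i(\boldsymbol u)=\mathbb{I}_N(J\boldsymbol a^i)\cdot\boldsymbol f(\boldsymbol u)=\sum_{n=1}^d\mathbb{I}_N(Ja^i_n)\,\boldsymbol f_n(\boldsymbol u)$. In each element, $\boldsymbol u^\delta$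 is the degree $N$ polynomial with nodal values $\boldsymbol u_{e,\boldsymbol p}$, and $\tilde{\boldsymbol f}^\delta$ is the degree $N$ polynomial interpolating $\tilde{\boldsymbol f}(\boldsymbol u_{e,\boldsymbol p})$ at the solution points. **Approximate Lax–Wendroff procedure (local to each element, all quantities at time level $n$).** With time step $\Delta t$, $$\tilde{\boldsymbol F}^\delta=\sum_{k=0}^N\frac{\Delta t^k}{(k+1)!}\,\partial_t^k\tilde{\boldsymbol f}^\delta,\qquad \boldsymbol U=\sum_{k=0}^N\frac{\Delta t^k}{(k+1)!}\,\partial_t^k\boldsymbol u^\delta .$$ For $N=1$, at each solution point, $$\boldsymbol u_t=-\frac1J\nabla_{\boldsymbol\xi}\cdot\tilde{\boldsymbol f}^\delta,\qquad \partial_t\tilde{\boldsymbol f}^\delta=\frac{\tilde{\boldsymbol f}(\boldsymbol u+\Delta t\,\boldsymbol u_t)-\tilde{\boldsymbol f}(\boldsymbol u-\Delta t\,\boldsymbol u_t)}{2\Delta t}.$$ For $N=2$, additionally, $$\boldsymbol u_{tt}=-\frac1J\nabla_{\boldsymbol\xi}\cdot\partial_t\tilde{\boldsymbol f}^\delta,\qquad \partial_{tt}\tilde{\boldsymbol f}^\delta=\frac1{\Delta t^2}\Big[\tilde{\boldsymbol f}\big(\boldsymbol u+\Delta t\,\boldsymbol u_t+\tfrac{\Delta t^2}{2}\boldsymbol u_{tt}\big)-2\tilde{\boldsymbol f}(\boldsymbol u)+\tilde{\boldsymbol f}\big(\boldsymbol u-\Delta t\,\boldsymbol u_t+\tfrac{\Delta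 t^2}{2}\boldsymbol u_{tt}\big)\Big].$$ The procedure for other degrees is similar: $\partial_t^k\boldsymbol u=-\frac1J\nabla_{\boldsymbol\xi}\cdot\partial_t^{k-1}\tilde{\boldsymbol f}^\delta$, and $\partial_t^k\tilde{\boldsymbol f}^\delta$ is obtained by finite differences in time of $\tilde{\boldsymbol f}$ evaluated at Taylor expansions of $\boldsymbol u$. Each $\partial_t^k\tilde{\boldsymbol f}^\delta$ is extended from its nodal values as a degree $N$ polynomial. **Faces and numerical flux.** For $1\le i\le d$ and $S\in\{L,R\}$, the face $(S,i)$ of $\Omega_o$ is $\{\xi^i=-1\}$ for $S=L$ and $\{\xi^i=1\}$ for $S=R$, with reference outward normals $\hat{\boldsymbol n}_{R,i}=\boldsymbol e_i$ (the Cartesian basis vector) and $\hat{\boldsymbol n}_{L,i}=-\boldsymbol e_i$. For a solution point $\boldsymbol\xi$, $\boldsymbol\xi_i^S$ is its projection to the face $(S,i)$. The numerical flux is $$(\tilde{\boldsymbol F}_e\cdot\hat{\boldsymbol n}_{S,i})^*=\tfrac12\big[(\tilde{\boldsymbol F}^\delta\cdot\hat{\boldsymbol n}_{S,i})^++(\tilde{\boldsymbol F}^\delta\cdot\hat{\boldsymbol n}_{S,i})^-\big]-\tfrac{\lambda_{S,i}}2\big(\boldsymbol U^+_{S,i}-\boldsymbol U^-_{S,i}\big),$$ where here $-$ denotes the trace from $\Omega_e$, $+$ the trace from the neighbouring element across the face, and $\lambda_{S,i}$ is a local wave speed estimate. **LWFR update.** With degree $N+1$ correction functions $g_L,g_R$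 satisfying $g_L(-1)=g_R(1)=1$, $g_L(1)=g_R(-1)=0$ (Huynh's $g_2$ functions are used), and $\boldsymbol\xi=\boldsymbol\xi_{\boldsymbol p}$, $$\boldsymbol u_{e,\boldsymbol p}^{n+1}=\boldsymbol u_{e,\boldsymbol p}^n-\frac{\Delta t}{J_{e,\boldsymbol p}}\nabla_{\boldsymbol\xi}\cdot\tilde{\boldsymbol F}^\delta_e(\boldsymbol\xi_{\boldsymbol p})-\frac{\Delta t}{J_{e,\boldsymbol p}}\sum_{i=1}^d\Big\{\big((\tilde{\boldsymbol F}_e\cdot\hat{\boldsymbol n}_{R,i})^*-\tilde{\boldsymbol F}^\delta_e\cdot\hat{\boldsymbol n}_{R,i}\big)(\boldsymbol\xi_i^R)\,g_R'(\xi_{p_i})-\big((\tilde{\boldsymbol F}_e\cdot\hat{\boldsymbol n}_{L,i})^*-\tilde{\boldsymbol F}^\delta_e\cdot\hat{\boldsymbol n}_{L,i}\big)(\boldsymbol\xi_i^L)\,g_L'(\xi_{p_i})\Big\}.$$ The first $\Delta t$-term is the volume term; the sum over $i$ gives the surface terms. *)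

(* Defs.v *)
From mathcomp Require Import all_boot all_order all_algebra.
From mathcomp Require Import reals.
From mathcomp Require Import mpoly.

Set Implicit Arguments.
Unset Strict Implicit.
Unset Printing Implicit Defensive.

Import Order.TTheory GRing.Theory Num.Theory.
Local Open Scope ring_scope.

(* Conventions.  A point of the reference element is a function 'I_d -> R.
   States and physical points are row vectors; a vector-valued polynomial in
   the reference coordinates is a row vector of elements of {mpoly R[d]}, and
   the partial derivative along the i-th coordinate is mderiv i. *)

Section Polynomials.
Variable R : realType.

(* Rodrigues' formula. *)
Definition legendre (n : nat) : {poly R} :=
  ((2 ^ n * n`!)%:R)^-1 *: (('X^2 - 1) ^+ n)^`(n).

(* The Gauss-Legendre-Lobatto points: -1, 1 and the N-1 roots of the derivative
   of the N-th Legendre polynomial, in increasing order. *)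
Definition gll_points (N : nat) (x : 'I_N.+1 -> R) : Prop :=
  [/\ forall j k : 'I_N.+1, (j < k)%N -> x j < x k,
      x ord0 = -1,
      x ord_max = 1
    & forall k : 'I_N.+1, k != ord0 -> k != ord_max ->
        root ((legendre N)^`()) (x k)].

(* mathcomp's own .-lagrange takes a sequence of points that is injective on the
   whole of nat, hence this version for finitely many points. *)
Definition lagrange1 (N : nat) (x : 'I_N.+1 -> R) (k : 'I_N.+1) : {poly R} :=
  \prod_(j < N.+1 | j != k) ((x k - x j)^-1 *: ('X - (x j)%:P)).

Variable d : nat.

Definition point := 'I_d -> R.

(* The univariate polynomial q in the i-th coordinate. *)
Definition in_var (i : 'I_d) (q : {poly R}) : {mpoly R[d]} :=
  (map_poly (@mpolyC d R) q).['X_i].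

(* Degree at most N in each variable (tensor product polynomials). *)
Definition tensor_degree_le (N : nat) (P : {mpoly R[d]}) : Prop :=
  forall m, m \in msupp P -> forall i : 'I_d, (m i <= N)%N.

Definition multi_index (N : nat) := {ffun 'I_d -> 'I_N.+1}.

Definition sol_pt (N : nat) (x : 'I_N.+1 -> R) (p : multi_index N) : point :=
  fun i => x (p i).

Definition lagrange_basis (N : nat) (x : 'I_N.+1 -> R) (p : multi_index N) :
    {mpoly R[d]} :=
  \prod_(i < d) in_var i (lagrange1 x (p i)).

(* The tensor product polynomial of degree N with nodal values v. *)
Definition interp (N : nat) (x : 'I_N.+1 -> R) (m : nat)
    (v : multi_index N -> 'rV[R]_m) : 'rV[{mpoly R[d]}]_m :=
  \row_j \sum_(p : multi_index N) v p 0 j *: lagrange_basis x p.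

Definition const_poly (m : nat) (c : 'rV[R]_m) : 'rV[{mpoly R[d]}]_m :=
  map_mx (@mpolyC d R) c.

Definition veval (m : nat) (q : 'rV[{mpoly R[d]}]_m) (xi : point) : 'rV[R]_m :=
  map_mx (fun P => P.@[xi]) q.

Definition divergence (m : nat) (F : 'I_d -> 'rV[{mpoly R[d]}]_m) :
    'rV[{mpoly R[d]}]_m :=
  \sum_(i < d) map_mx (mderiv i) (F i).

End Polynomials.

Variant side := Left | Right.

Section Reference.
Variables (R : realType) (d : nat).

Definition ref_elt (xi : point R d) : Prop := forall i, -1 <= xi i <= 1.

Definition ref_interior (xi : point R d) : Prop := forall i, -1 < xi i < 1.

Definition face_coord (S : side) : R := if S is Left then -1 else 1.

Definition on_face (S : side) (i : 'I_d) (xi : point R d) : Prop :=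
  ref_elt xi /\ xi i = face_coord S.

Definition normal (S : side) (i m : 'I_d) : R :=
  if m == i then face_coord S else 0.

Definition proj_face (S : side) (i : 'I_d) (xi : point R d) : point R d :=
  fun m => if m == i then face_coord S else xi m.

End Reference.

(* The domain is the union of the images of the reference element under the
   maps of the elements.  Every face has a neighbour across it: physical
   boundaries are either absent or identified periodically, in which case
   shift is the period vector (shift is 0 on an ordinary interior face).
   - node e p is the image of the p-th solution point under the map of e;
   - metric e i n is the polynomial I_N(J a^i_n) that the scheme uses in e;
   - nbr e S i is the element across the face (S, i) of e, nbr_face e S i the
     name of that face in the neighbour, and nbr_pt e S i sends a point of the
     face to the reference coordinates of the same physical point in the
     neighbour. *)
Record mesh (R : realType) (d N : nat) := Mesh {
  elt : Type;
  node : elt -> multi_index d N -> 'rV[R]_d;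
  metric : elt -> 'I_d -> 'I_d -> {mpoly R[d]};
  nbr : elt -> side -> 'I_d -> elt;
  nbr_face : elt -> side -> 'I_d -> side * 'I_d;
  nbr_pt : elt -> side -> 'I_d -> point R d -> point R d;
  shift : elt -> side -> 'I_d -> 'rV[R]_d
}.

Section Scheme.
Variables (R : realType) (d N M : nat).
Variables (x : 'I_N.+1 -> R) (msh : mesh R d N).

Definition ref_map (e : elt msh) : 'rV[{mpoly R[d]}]_d := interp x (node e).

Definition jacobian_mx (e : elt msh) (xi : point R d) : 'M[R]_d :=
  \matrix_(n < d, i < d) (mderiv i (ref_map e 0 n)).@[xi].

Definition jac (e : elt msh) (xi : point R d) : R := \det (jacobian_mx e xi).

(* The n-th component of the gradient in x of the reference coordinate xi^i;
   the Jacobian matrix of the inverse map is the inverse matrix. *)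
Definition contravariant (e : elt msh) (xi : point R d) (i n : 'I_d) : R :=
  invmx (jacobian_mx e xi) i n.

(* In 2-D the metric terms of a map of degree N are themselves polynomials of
   degree N and the scheme uses them exactly; in other dimensions any
   approximation of degree N is allowed. *)
Record mesh_spec : Prop := MeshSpec {
  map_inj : forall e xi eta, ref_elt xi -> ref_elt eta ->
    veval (ref_map e) xi = veval (ref_map e) eta -> xi =1 eta;
  map_jac : forall e xi, ref_elt xi -> jac e xi != 0;
  non_overlapping : forall e1 e2 xi1 xi2,
    ref_interior xi1 -> ref_interior xi2 ->
    veval (ref_map e1) xi1 = veval (ref_map e2) xi2 -> e1 = e2;
  nbr_proper : forall (e : elt msh) S i,
    ~ (nbr e S i = e /\ nbr_face e S i = (S, i));
  nbr_sym : forall (e : elt msh) S i,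
    let e' := nbr e S i in
    let f' := nbr_face e S i in
    nbr e' f'.1 f'.2 = e /\ nbr_face e' f'.1 f'.2 = (S, i);
  nbr_pt_face : forall (e : elt msh) S i xi, on_face S i xi ->
    on_face (nbr_face e S i).1 (nbr_face e S i).2 (nbr_pt e S i xi);
  map_continuous : forall e S i xi, on_face S i xi ->
    veval (ref_map (nbr e S i)) (nbr_pt e S i xi) =
      veval (ref_map e) xi + shift e S i;
  metric_degree : forall (e : elt msh) i n, tensor_degree_le N (metric e i n);
  metric_2d : d = 2%N -> forall e i n xi, ref_elt xi ->
    (metric e i n).@[xi] = jac e xi * contravariant e xi i n
}.

Definition metric_identities : Prop :=
  forall (e : elt msh) (n : 'I_d), \sum_(i < d) mderiv i (metric e i n) = 0.

Definition well_constructed : Prop :=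
  forall (e : elt msh) (S : side) (i : 'I_d) (xi : point R d),
    on_face S i xi -> forall n : 'I_d,
    \sum_(m < d) ((metric (nbr e S i) m n).@[nbr_pt e S i xi]
                   - (metric e m n).@[xi]) * normal R S i m = 0.

Variable f : 'I_d -> 'rV[R]_M -> 'rV[R]_M.

Definition contra_flux (e : elt msh) (p : multi_index d N) (w : 'rV[R]_M) (i : 'I_d) :
    'rV[R]_M :=
  \sum_(n < d) (metric e i n).@[sol_pt x p] *: f n w.

Definition flux_poly (e : elt msh) (v : multi_index d N -> 'rV[R]_M) (i : 'I_d) :
    'rV[{mpoly R[d]}]_M :=
  interp x (fun p => contra_flux e p (v p) i).

(* A finite difference formula is a list of pairs (weight, offset), offsets
   being in units of dt.  It approximates the k-th derivative: exact, for
   dt = 1, on the monomials of degree at most k. *)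
Definition fd_consistent (k : nat) (st : seq (R * R)) : Prop :=
  forall r, (r <= k)%N ->
    \sum_(ws <- st) ws.1 * ws.2 ^+ r = if r == k then k`!%:R else 0.

(* fd k is the formula used for the k-th time derivative of the flux.  It is
   prescribed when N is 1 or 2. *)
Definition lw_stencils (fd : nat -> seq (R * R)) : Prop :=
  [/\ forall k, (0 < k <= N)%N -> fd_consistent k (fd k),
      (0 < N <= 2)%N -> fd 1%N = [:: (2^-1, 1); (- 2^-1, -1)]
    & N = 2%N -> fd 2%N = [:: (1, 1); (-2, 0); (1, -1)]].

Variables (fd : nat -> seq (R * R)) (dt : R).

Section Local.
Variables (e : elt msh) (v : multi_index d N -> 'rV[R]_M).

Definition taylor (us : seq (multi_index d N -> 'rV[R]_M)) (s : R) (p : multi_index d N) :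
    'rV[R]_M :=
  \sum_(l < size us) ((s * dt) ^+ l / l`!%:R) *: nth (fun=> 0) us l p.

(* The polynomial of the k-th time derivative of the flux, us being the list of
   the time derivatives of orders 0, ..., k of the solution. *)
Definition dt_flux_of (us : seq (multi_index d N -> 'rV[R]_M)) (i : 'I_d) :
    'rV[{mpoly R[d]}]_M :=
  let k := (size us).-1 in
  if k is 0%N then flux_poly e (nth (fun=> 0) us 0) i
  else interp x (fun p => (dt ^+ k)^-1 *:
         \sum_(ws <- fd k) ws.1 *: contra_flux e p (taylor us ws.2 p) i).

(* The nodal values of the time derivatives of orders 0, ..., k. *)
Fixpoint dt_sol_seq (k : nat) : seq (multi_index d N -> 'rV[R]_M) :=
  if k is k'.+1 then
    let us := dt_sol_seq k' in
    rcons us (fun p => - (jac e (sol_pt x p))^-1 *: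
                         veval (divergence (dt_flux_of us)) (sol_pt x p))
  else [:: v].

Definition dt_sol (k : nat) : multi_index d N -> 'rV[R]_M :=
  nth (fun=> 0) (dt_sol_seq k) k.

Definition dt_flux (k : nat) (i : 'I_d) : 'rV[{mpoly R[d]}]_M :=
  dt_flux_of (dt_sol_seq k) i.

Definition tavg_flux (i : 'I_d) : 'rV[{mpoly R[d]}]_M :=
  \sum_(k < N.+1) (dt ^+ k / k.+1`!%:R)%:MP *: dt_flux k i.

Definition tavg_sol : 'rV[{mpoly R[d]}]_M :=
  \sum_(k < N.+1) (dt ^+ k / k.+1`!%:R)%:MP *: interp x (dt_sol k).

End Local.

(* The wave speed estimate lam e S i xi may vary along the faces.  Its
   dependence on the solution is left implicit. *)
Variables (g : side -> {poly R}) (lam : elt msh -> side -> 'I_d -> point R d -> R).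
Variable u : elt msh -> multi_index d N -> 'rV[R]_M.

Definition correction_functions : Prop :=
  [/\ forall S, size (g S) = N.+2,
      (g Left).[-1] = 1, (g Left).[1] = 0,
      (g Right).[1] = 1 & (g Right).[-1] = 0].

Definition normal_flux (e : elt msh) (S : side) (i : 'I_d) (xi : point R d) :
    'rV[R]_M :=
  \sum_(m < d) normal R S i m *: veval (tavg_flux e (u e) m) xi.

(* The normal of the exterior trace is that of the face (S, i) of e. *)
Definition normal_flux_ext (e : elt msh) (S : side) (i : 'I_d)
    (xi : point R d) : 'rV[R]_M :=
  let e' := nbr e S i in
  \sum_(m < d) normal R S i m *:
    veval (tavg_flux e' (u e') m) (nbr_pt e S i xi).

Definition sol_jump (e : elt msh) (S : side) (i : 'I_d) (xi : point R d) :
    'rV[R]_M :=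
  let e' := nbr e S i in
  veval (tavg_sol e' (u e')) (nbr_pt e S i xi) - veval (tavg_sol e (u e)) xi.

Definition num_flux (e : elt msh) (S : side) (i : 'I_d) (xi : point R d) :
    'rV[R]_M :=
  2^-1 *: (normal_flux_ext e S i xi + normal_flux e S i xi)
  - (lam e S i xi / 2) *: sol_jump e S i xi.

Definition volume_term (e : elt msh) (p : multi_index d N) : 'rV[R]_M :=
  (dt / jac e (sol_pt x p)) *:
    veval (divergence (tavg_flux e (u e))) (sol_pt x p).

Definition face_term (e : elt msh) (p : multi_index d N) (S : side) (i : 'I_d) :
    'rV[R]_M :=
  let xiS := proj_face S i (sol_pt x p) in
  ((g S)^`()).[x (p i)] *: (num_flux e S i xiS - normal_flux e S i xiS).

Definition surface_term (e : elt msh) (p : multi_index d N) : 'rV[R]_M :=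
  (dt / jac e (sol_pt x p)) *:
    \sum_(i < d) (face_term e p Right i - face_term e p Left i).

Definition lwfr_update (e : elt msh) (p : multi_index d N) : 'rV[R]_M :=
  u e p - volume_term e p - surface_term e p.

End Scheme.

(* Main.v *)
Require Import Defs.
From HB Require Import structures.
From mathcomp Require Import all_boot all_order all_algebra.
From mathcomp Require Import reals.
From mathcomp Require Import mpoly.

Set Implicit Arguments.
Unset Strict Implicit.
Unset Printing Implicit Defensive.

Import Order.TTheory GRing.Theory Num.Theory.
Local Open Scope ring_scope.

(* Interpolation at the solution points is exact on tensor product polynomials,
   so at a constant state the flux polynomial is the metric contracted with
   f(c) and the metric identities make its divergence zero.  Hence every time
   derivative of the solution vanishes, all Taylor expansions equal c, and the
   finite difference formulas, whose weights sum to zero, return zero time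
   derivatives of the flux.  At a face the two traces of the normal flux differ
   by f(c) contracted with the jump of the normal metric terms, which is zero. *)

(** * Exactness of tensor product interpolation at distinct nodes *)

Section Interpolation.
Variables (R : realType) (d N : nat) (x : 'I_N.+1 -> R).
Hypothesis x_inj : injective x.

Lemma lagrange1_eval (j k : 'I_N.+1) : (lagrange1 x k).[x j] = (j == k)%:R.
Proof.
rewrite /lagrange1 horner_prod; case: (eqVneq j k) => [->|njk].
  rewrite big1 // => i nik; rewrite !hornerE mulVf // subr_eq0.
  by apply: contraNneq nik => /x_inj->.
by rewrite (bigD1 j) //= !hornerE subrr mulr0 mul0r.
Qed.

Lemma size_lagrange1 (k : 'I_N.+1) : (size (lagrange1 x k) <= N.+1)%N.
Proof.
rewrite /lagrange1; apply: leq_trans (size_poly_prod_leq _ _) _.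
rewrite leq_subLR; set A := #|_|.
have hA : A = N by rewrite /A cardC1 card_ord.
(* The [N] factors have size at most 2, so the claim reduces to [2 * N + 1 <= N + N.+1]. *)
apply: (@leq_trans (\sum_(i < N.+1 | i != k) 2).+1).
  rewrite ltnS; apply: leq_sum => i _.
  by apply: leq_trans (size_scale_leq _ _) _; rewrite size_XsubC.
by rewrite sum_nat_const -/A hA muln2 -addnn addnS.
Qed.

(** The difference of the two sides has size at most [N.+1] and vanishes at the [N.+1] distinct
    nodes, so it is zero. *)
Lemma lagrange1_interp (q : {poly R}) : (size q <= N.+1)%N ->
  \sum_(k < N.+1) q.[x k] *: lagrange1 x k = q.
Proof.
move=> sq; set s := \sum_(k < _) _; apply/eqP; rewrite -subr_eq0.
apply: contraT => nz; have := @max_poly_roots _ (s - q) (codom x) nz.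
rewrite size_codom card_ord map_inj_uniq // enum_uniq => /(_ _ isT) lt_size.
suff: (N.+1 < N.+1)%N by rewrite ltnn.
apply: leq_trans (lt_size _) _; last first.
  apply: leq_trans (size_polyD _ _) _; rewrite size_polyN geq_max sq andbT.
  apply: leq_trans (size_sum _ _ _) _; apply/bigmax_leqP => k _.
  exact: leq_trans (size_scale_leq _ _) (size_lagrange1 k).
apply/allP => _ /codomP[j ->]; rewrite rootE hornerD hornerN horner_sum.
rewrite (bigD1 j) //= big1 => [|k nkj].
  by rewrite hornerZ lagrange1_eval eqxx mulr1 addr0 subrr.
by rewrite hornerZ lagrange1_eval eq_sym (negPf nkj) mulr0.
Qed.

(** Linearity carries the univariate interpolation identity over to each coordinate of a
    multivariate polynomial. *)
Lemma in_var_is_linear (i : 'I_d) : linear (@in_var R d i).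
Proof.
move=> a p q; rewrite /in_var -!mul_polyC !rmorphD !rmorphM /= map_polyC /=.
by rewrite hornerD hornerM hornerC mul_mpolyC.
Qed.
HB.instance Definition _ (i : 'I_d) :=
  GRing.isLinear.Build R {poly R} {mpoly R[d]} _ (@in_var R d i)
    (in_var_is_linear i).

Lemma in_varXn (i : 'I_d) n : in_var i ('X^n : {poly R}) = 'X_i ^+ n.
Proof. by rewrite /in_var map_polyXn hornerXn. Qed.

(** Nodal values of a monomial and basis polynomials both factor over the coordinates, so the sum
    over multi-indices is the expansion of a product of univariate interpolation sums. *)
Lemma lagrange_basis_interpX (m : 'X_{1..d}) : (forall i, (m i <= N)%N) ->
  \sum_(p : multi_index d N) ('X_[R, m]).@[sol_pt x p] *: lagrange_basis x p
    = 'X_[m].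
Proof.
move=> le_m; rewrite [RHS]mpolyXE_id.
transitivity (\prod_(i < d) \sum_(k < N.+1)
    x k ^+ m i *: in_var i (lagrange1 x k)); last first.
  apply: eq_bigr => i _.
  rewrite -in_varXn -[in RHS](@lagrange1_interp 'X^(m i)).
    rewrite linear_sum; apply: eq_bigr => k _.
    by rewrite linearZ /= hornerXn.
  by rewrite size_polyXn ltnS.
rewrite bigA_distr_bigA; apply: eq_bigr => p _.
by rewrite mevalX scaler_prod.
Qed.

Lemma lagrange_basis_interp (P : {mpoly R[d]}) : tensor_degree_le N P ->
  \sum_(p : multi_index d N) P.@[sol_pt x p] *: lagrange_basis x p = P.
Proof.
move=> degP; rewrite [RHS]mpolyE.
transitivity (\sum_(p : multi_index d N) \sum_(m <- msupp P)
    (P@_m * ('X_[R, m]).@[sol_pt x p]) *: lagrange_basis x p).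
  apply: eq_bigr => p _; rewrite -scaler_suml; congr (_ *: _).
  rewrite [in LHS](mpolyE P) raddf_sum; apply: eq_bigr => m _ /=.
  by rewrite mevalZ.
(* Membership in [msupp P] is kept, since the degree bound holds only for those monomials. *)
rewrite exchange_big /= !big_seq; apply: eq_bigr => m Pm.
rewrite -[in RHS](@lagrange_basis_interpX m); last exact: degP.
by rewrite scaler_sumr; apply: eq_bigr => p _; rewrite scalerA.
Qed.

Lemma tensor_degree_leC (a : R) : tensor_degree_le N (a%:MP_[d]).
Proof.
move=> m; rewrite msuppC; case: ifP => // _.
by rewrite inE => /eqP-> i; rewrite mnm0E.
Qed.

Lemma eq_interp (M : nat) (v w : multi_index d N -> 'rV[R]_M) :
  v =1 w -> interp x v = interp x w.
Proof.
by move=> vw; apply/rowP=> j; rewrite !mxE; apply: eq_bigr => p _; rewrite vw.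
Qed.

Lemma interp0 (M : nat) (v : multi_index d N -> 'rV[R]_M) :
  (forall p, v p = 0) -> interp x v = 0.
Proof.
by move=> v0; apply/rowP=> j; rewrite !mxE big1 // => p _;
   rewrite v0 mxE scale0r.
Qed.

Lemma interp_const (M : nat) (c : 'rV[R]_M) :
  interp x (fun=> c) = const_poly d c.
Proof.
apply/rowP=> j; rewrite !mxE -[RHS]lagrange_basis_interp; last first.
  exact: tensor_degree_leC.
by apply: eq_bigr => p _; rewrite mevalC.
Qed.

End Interpolation.

(** * Location of the GLL points in the reference element *)

Section GLL.
Variables (R : realType) (N : nat) (x : 'I_N.+1 -> R).
Hypothesis gll_x : gll_points x.

Lemma gll_points_inj : injective x.
Proof.
case: gll_x => lt_x _ _ _ j k eq_x; apply/val_inj/eqP; case: ltngtP => // lt_jk.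
  by have := lt_x _ _ lt_jk; rewrite eq_x ltxx.
by have := lt_x _ _ lt_jk; rewrite eq_x ltxx.
Qed.

Lemma gll_points_itv k : -1 <= x k <= 1.
Proof.
case: gll_x => lt_x x0 xN _.
have le_x (i j : 'I_N.+1) : (i <= j)%N -> x i <= x j.
  rewrite leq_eqVlt => /orP[/eqP/val_inj->//|/lt_x/ltW//].
by rewrite -{1}x0 -xN !le_x //= -ltnS.
Qed.

(** This makes [well_constructed] applicable at the points where the face terms are evaluated. *)
Lemma on_face_proj_face d S i (p : multi_index d N) :
  on_face S i (proj_face S i (sol_pt x p)).
Proof.
split; last by rewrite /proj_face eqxx.
move=> m; rewrite /proj_face; case: ifP => _; last exact: gll_points_itv.
by case: S => /=; rewrite lexx ?andbT /= ge0_cp ?ler01.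
Qed.

End GLL.

(** * The local Lax-Wendroff procedure at a constant state *)

Section FreeStream.
Variables (R : realType) (d N M : nat) (x : 'I_N.+1 -> R) (msh : mesh R d N).
Hypothesis x_inj : injective x.
Hypothesis metric_deg :
  forall (e : elt msh) i n, tensor_degree_le N (metric e i n).
Variable f : 'I_d -> 'rV[R]_M -> 'rV[R]_M.

Lemma eq_flux_poly (e : elt msh) (v w : multi_index d N -> 'rV[R]_M) i :
  v =1 w -> flux_poly x f e v i = flux_poly x f e w i.
Proof. by move=> vw; apply: eq_interp => p; rewrite vw. Qed.

(** With [c] fixed, the nodal fluxes are values of a constant combination of metric polynomials,
    which have degree at most [N] in each variable; interpolation reproduces it. *)
Lemma flux_poly_const (e : elt msh) (c : 'rV[R]_M) i :
  flux_poly x f e (fun=> c) i =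
    \sum_(n < d) metric e i n *: const_poly d (f n c).
Proof.
apply/rowP=> j; rewrite !mxE summxE.
transitivity (\sum_(p : multi_index d N) \sum_(n < d)
    f n c 0 j *: ((metric e i n).@[sol_pt x p] *: lagrange_basis x p)).
  apply: eq_bigr => p _; rewrite summxE scaler_suml; apply: eq_bigr => n _.
  by rewrite !mxE scalerA mulrC.
rewrite exchange_big /=; apply: eq_bigr => n _.
by rewrite -scaler_sumr lagrange_basis_interp // !mxE mulrC mul_mpolyC.
Qed.

(** The derivatives fall only on the metric, and collecting the terms in [f n c] leaves the [n]-th
    component of the metric identities as coefficient. *)
Lemma divergence_flux_poly_const (e : elt msh) (c : 'rV[R]_M) :
  metric_identities msh -> divergence (flux_poly x f e (fun=> c)) = 0.
Proof.
move=> hmetric; apply/rowP=> j; rewrite summxE mxE.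
transitivity (\sum_(n < d) f n c 0 j *: (\sum_(i < d) mderiv i (metric e i n))).
  under [RHS]eq_bigr do rewrite scaler_sumr; rewrite exchange_big /=.
  apply: eq_bigr => i _; rewrite mxE flux_poly_const summxE raddf_sum.
  by apply: eq_bigr => n _ /=; rewrite !mxE mulrC mul_mpolyC mderivZ.
by rewrite big1 // => n _; rewrite hmetric scaler0.
Qed.

Lemma divergence0 (F : 'I_d -> 'rV[{mpoly R[d]}]_M) :
  (forall i, F i = 0) -> divergence F = 0.
Proof.
move=> F0; rewrite /divergence big1 // => i _; rewrite F0.
by apply/rowP=> j; rewrite !mxE linear0.
Qed.

Lemma veval0 xi : veval (0 : 'rV[{mpoly R[d]}]_M) xi = 0.
Proof. by apply/rowP=> j; rewrite !mxE rmorph0. Qed.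

Lemma eq_divergence (F G : 'I_d -> 'rV[{mpoly R[d]}]_M) :
  F =1 G -> divergence F = divergence G.
Proof. by move=> FG; apply: eq_bigr => i _; rewrite FG. Qed.

(** This is exactness on constants, the case [r = 0] of consistency. *)
Lemma fd_consistent_sum0 k st : (0 < k)%N -> fd_consistent k st ->
  \sum_(ws <- st) ws.1 = 0 :> R.
Proof.
move=> k_gt0 /(_ 0%N (leq0n _)); case: eqP => [k0 _|_ sum0].
  by rewrite -k0 in k_gt0.
by rewrite -[RHS]sum0; apply: eq_bigr => ws _; rewrite expr0 mulr1.
Qed.

Variables (fd : nat -> seq (R * R)) (dt : R).
Hypothesis fd_ok : forall k, (0 < k <= N)%N -> fd_consistent k (fd k).
Hypothesis hmetric : metric_identities msh.
Variables (e : elt msh) (v : multi_index d N -> 'rV[R]_M) (c : 'rV[R]_M).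
Hypothesis v_const : forall p, v p = c.

(** The index [l] can range over all of [nat] because the default [fun=> 0] agrees with the required
    value past the end of the list. *)
Let steady (us : seq (multi_index d N -> 'rV[R]_M)) :=
  (0 < size us)%N /\
  forall l p, nth (fun=> 0) us l p = if l == 0%N then c else 0.

Lemma taylor_steady us s p : steady us -> taylor dt us s p = c.
Proof.
case: us => [[]|w us [_ hus]]; first by [].
rewrite /taylor /= big_ord_recl big1 => [|l _]; last by rewrite hus scaler0.
by rewrite hus expr0 divr1 scale1r addr0.
Qed.

(** For order [(size us).-1 > 0], every stencil point gives the flux at [c], which factors out and
    leaves the zero sum of the weights. The size bound keeps the order at most [N], where [fd] is
    consistent. *)
Lemma dt_flux_of_steady us i : steady us -> (size us <= N.+1)%N ->
  dt_flux_of x f fd dt e us i =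
    if size us == 1%N then flux_poly x f e (fun=> c) i else 0.
Proof.
move=> hus; have [us_gt0 us_nth] := hus; rewrite /dt_flux_of.
case size_us: (size us) => [|[|k]] /= le_k; first by rewrite size_us in us_gt0.
  by apply: eq_flux_poly => p; rewrite us_nth.
apply: interp0 => p; under eq_bigr do rewrite taylor_steady //.
rewrite -scaler_suml (@fd_consistent_sum0 k.+1) ?scale0r ?scaler0 //.
exact: fd_ok.
Qed.

Lemma size_dt_sol_seq k : size (dt_sol_seq x f fd dt e v k) = k.+1.
Proof. by elim: k => //= k IHk; rewrite size_rcons IHk. Qed.

(** By induction, the entry appended at each step is a multiple of the divergence of the last flux
    derivative, and that divergence is zero. *)
Lemma dt_sol_seq_steady k : (k <= N)%N -> steady (dt_sol_seq x f fd dt e v k).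
Proof.
elim: k => [_|k IHk lt_k]; first by split=> // -[|[|l]] p /=.
have hus := IHk (ltnW lt_k); split=> [|l p]; first by rewrite size_dt_sol_seq.
rewrite /= nth_rcons size_dt_sol_seq; have [_ us_nth] := hus.
case: ltnP => [lt_l|le_l]; first exact: us_nth.
case: eqP => [->|_]; last by case: l le_l.
suff -> : divergence (dt_flux_of x f fd dt e (dt_sol_seq x f fd dt e v k)) = 0.
  by rewrite veval0 scaler0.
have eqF i := dt_flux_of_steady i hus.
rewrite size_dt_sol_seq in eqF.
(* The first time derivative vanishes by the metric identities; for later ones the flux derivative
   is itself zero. *)
case: k lt_k {IHk hus us_nth le_l} eqF => [|k] lt_k eqF.
  rewrite -(divergence_flux_poly_const e c hmetric).
  by apply: eq_divergence => i; rewrite eqF.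
by apply: divergence0 => i; rewrite eqF // ltnW.
Qed.

Lemma dt_flux_const k i : (k <= N)%N ->
  dt_flux x f fd dt e v k i =
    if k == 0%N then flux_poly x f e (fun=> c) i else 0.
Proof.
move=> le_k; rewrite /dt_flux dt_flux_of_steady ?size_dt_sol_seq //.
exact: dt_sol_seq_steady.
Qed.

Lemma dt_sol_const k p : (k <= N)%N ->
  dt_sol x f fd dt e v k p = if k == 0%N then c else 0.
Proof. by rewrite /dt_sol => /dt_sol_seq_steady[_ ->]. Qed.

Lemma tavg_flux_const i :
  tavg_flux x f fd dt e v i = flux_poly x f e (fun=> c) i.
Proof.
rewrite /tavg_flux big_ord_recl big1 => [|k _]; last first.
  by rewrite dt_flux_const ?scaler0 //= ltn_ord.
(* Only order 0 survives, with coefficient [dt ^+ 0 / 1! = 1]. *)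
by rewrite dt_flux_const //= expr0 divr1 scale1r addr0.
Qed.

Lemma tavg_sol_const : tavg_sol x f fd dt e v = const_poly d c.
Proof.
rewrite /tavg_sol big_ord_recl big1 => [|k _]; last first.
  by rewrite interp0 ?scaler0 // => p; rewrite dt_sol_const //= ltn_ord.
rewrite /= expr0 divr1 scale1r addr0 -(interp_const d x_inj).
by apply: eq_interp => p; rewrite dt_sol_const.
Qed.

End FreeStream.

(** * Continuity of the normal flux across faces *)

Section Faces.
Variables (R : realType) (d N M : nat) (x : 'I_N.+1 -> R) (msh : mesh R d N).
Hypothesis x_inj : injective x.
Hypothesis metric_deg :
  forall (e : elt msh) i n, tensor_degree_le N (metric e i n).
Variable f : 'I_d -> 'rV[R]_M -> 'rV[R]_M.

(** Exchanging the sums isolates the normal metric terms, the quantity whose jump [well_constructed]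
    controls. *)
Lemma normal_flux_poly_const (e : elt msh) (c : 'rV[R]_M) S i (xi : point R d) :
  \sum_(m < d) normal R S i m *: veval (flux_poly x f e (fun=> c) m) xi =
  \sum_(n < d) (\sum_(m < d) (metric e m n).@[xi] * normal R S i m) *: f n c.
Proof.
apply/rowP=> j; rewrite !summxE.
under [RHS]eq_bigr do rewrite mxE mulr_suml.
rewrite exchange_big /=; apply: eq_bigr => m _.
rewrite mxE mxE flux_poly_const // summxE raddf_sum mulr_sumr.
apply: eq_bigr => n _; rewrite !mxE /= mevalM mevalC mulrA.
by rewrite [normal _ _ _ _ * _]mulrC.
Qed.

Lemma normal_flux_poly_const_nbr (e : elt msh) (c : 'rV[R]_M) S i xi :
  well_constructed msh -> on_face S i xi ->
  \sum_(m < d) normal R S i m *: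
      veval (flux_poly x f (nbr e S i) (fun=> c) m) (nbr_pt e S i xi) =
  \sum_(m < d) normal R S i m *: veval (flux_poly x f e (fun=> c) m) xi.
Proof.
move=> hwell face_xi; rewrite !normal_flux_poly_const.
apply: eq_bigr => n _; congr (_ *: _); apply/eqP; rewrite -subr_eq0.
have /eqP := hwell e S i xi face_xi n.
by under eq_bigr do rewrite mulrBl; rewrite sumrB.
Qed.

End Faces.

(** * Free stream preservation of the full update *)

Lemma half_scaleD (R : numFieldType) (V : lmodType R) (v : V) :
  2^-1 *: (v + v) = v.
Proof.
have half2 : 2^-1 + 2^-1 = 1 :> R by rewrite [RHS](splitr 1) div1r.
by rewrite scalerDr -scalerDl half2 scale1r.
Qed.

Theorem mainTheorem1 (R : realType) (d N M : nat) (hN : (0 < N)%N)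
  (x : 'I_N.+1 -> R) (hx : gll_points x)
  (msh : mesh R d N) (hmsh : mesh_spec x msh)
  (f : 'I_d -> 'rV[R]_M -> 'rV[R]_M)
  (fd : nat -> seq (R * R)) (hfd : lw_stencils N fd)
  (dt : R) (hdt : 0 < dt)
  (g : side -> {poly R}) (hg : correction_functions N g)
  (lam : elt msh -> side -> 'I_d -> point R d -> R)
  (hmetric : metric_identities msh)
  (hwell : well_constructed msh)
  (u : elt msh -> multi_index d N -> 'rV[R]_M) (c : 'rV[R]_M)
  (hu : forall e p, u e p = c) :
  [/\ forall e i,
        tavg_flux x f fd dt e (u e) i = flux_poly x f e (fun=> c) i
        /\ flux_poly x f e (fun=> c) i
             = \sum_(n < d) metric e i n *: const_poly d (f n c),
      forall e,
        tavg_sol x f fd dt e (u e) = interp x (u e)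
        /\ interp x (u e) = const_poly d c,
      forall e p, volume_term x f fd dt u e p = 0,
      forall e p,
        (forall S i, face_term x f fd dt g lam u e p S i = 0)
        /\ surface_term x f fd dt g lam u e p = 0
    & forall e p, lwfr_update x f fd dt g lam u e p = c].
Proof.
have x_inj := gll_points_inj hx.
have deg := metric_degree hmsh.
have fd_ok : forall k, (0 < k <= N)%N -> fd_consistent k (fd k) by case: hfd.
have avgF e i : tavg_flux x f fd dt e (u e) i = flux_poly x f e (fun=> c) i.
  exact: tavg_flux_const.
have avgU e : tavg_sol x f fd dt e (u e) = const_poly d c.
  exact: tavg_sol_const.
have vol e p : volume_term x f fd dt u e p = 0.
  rewrite /volume_term (eq_divergence (avgF e)).
  by rewrite divergence_flux_poly_const // veval0 scaler0.
have face e p S i : face_term x f fd dt g lam u e p S i = 0.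
  rewrite /face_term; set xi := proj_face _ _ _.
  have face_xi : on_face S i xi by exact: on_face_proj_face.
  (* The central part averages two equal traces, and the dissipative part vanishes because the time
     averaged solution is the same constant in both elements. *)
  have -> : num_flux x f fd dt lam u e S i xi =
            normal_flux x f fd dt u e S i xi.
    have ext : normal_flux_ext x f fd dt u e S i xi =
               normal_flux x f fd dt u e S i xi.
      rewrite /normal_flux_ext /normal_flux.
      transitivity (\sum_(m < d) normal R S i m *:
          veval (flux_poly x f (nbr e S i) (fun=> c) m) (nbr_pt e S i xi)).
        by apply: eq_bigr => m _; rewrite avgF.
      rewrite normal_flux_poly_const_nbr //.
      by apply: eq_bigr => m _; rewrite avgF.
    have jump : sol_jump x f fd dt u e S i xi = 0.
      rewrite /sol_jump !avgU; apply/rowP=> j.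
      by rewrite !mxE /= !mevalC subrr.
    rewrite /num_flux ext jump scaler0 subr0.
    exact: half_scaleD.
  by rewrite subrr scaler0.
have surf e p : surface_term x f fd dt g lam u e p = 0.
  by rewrite /surface_term big1 ?scaler0 // => i _; rewrite !face subrr.
have interpU e : interp x (u e) = const_poly d c.
  by rewrite -(interp_const d x_inj); apply: eq_interp.
split=> //.
- by move=> e i; split; [exact: avgF | exact: flux_poly_const].
- by move=> e; rewrite avgU interpU.
- by move=> e p; rewrite /lwfr_update vol surf !subr0 hu.
Qed.
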